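(* Relative to $\mathcal E_3^{\mathrm{nd}}$, the three fixed points $(1,-1,-1)$, $(-1,1,-1)$, $(-1,-1,1)$ of $T$ are locally asymptotically stable, whereas the four fixed points $\bigl(-\tfrac12,-\tfrac12,-\tfrac12\bigr)$, $(-1,0,0)$, $(0,-1,0)$, $(0,0,-1)$ of $T$ are Lyapunov unstable.
   Context: For nonconstant $x,y\in\mathbb R^3$, with means $\bar x,\bar y$, the Pearson correlation is $\operatorname{corr}(x,y)=\frac{\sum_k(x_k-\bar x)(y_k-\bar y)}{\sqrt{\sum_k(x_k-\bar x)^2\sum_k(y_k-\bar y)^2}}$. For a real $3\times3$ matrix $A$ with nonconstant rows $r_1,r_2,r_3$, the correlation map is $[C(A)]_{ij}=\operatorname{corr}(r_i,r_j)$. For real $a,b,c$ let $A(a,b,c)=\begin{pmatrix} 1 & a & b \\ a & 1 & c \\ b & c & 1 \end{pmatrix}$. Let $\mathcal E_3=\{(a,b,c)\in[-1,1]^3:1+2abc-a^2-b^2-c^2\ge0\}$, and let $\mathcal E_3^{\mathrm{nd}}$ be the set of $(a,b,c)\in\mathcal E_3$ such that all rows of $A(a,b,c)$ are nonconstant; one has $\mathcal E_3^{\mathrm{nd}}=\mathcal E_3\setminus\{(1,1,1)\}$. The map $T:\mathcal E_3^{\mathrm{nd}}\to\mathcal E_3^{\mathrm{nd}}$ is defined by $A(T(p))=C(A(p))$. A fixed point $p\in\mathcal E_3^{\mathrm{nd}}$ of $T$ is Lyapunov stable relative to $\mathcal E_3^{\mathrm{nd}}$ if for every relative neighborhood $V$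 of $p$ in $\mathcal E_3^{\mathrm{nd}}$ there is a relative neighborhood $U$ of $p$ such that every orbit starting in $U$ is defined for all forward iterates and remains in $V$. It is locally asymptotically stable relative to $\mathcal E_3^{\mathrm{nd}}$ if it is Lyapunov stable and every orbit starting in some relative neighborhood of $p$ converges to $p$. A fixed point that is not Lyapunov stable is called (Lyapunov) unstable. *)

(* Defs.v *)
From HB Require Import structures.
From mathcomp Require Import all_boot all_order all_algebra.
From mathcomp Require Import all_classical all_reals all_analysis.
From mathcomp Require Import ring lra.

Set Implicit Arguments.
Unset Strict Implicit.
Unset Printing Implicit Defensive.

Import Order.TTheory GRing.Theory Num.Theory.
Import numFieldNormedType.Exports.

Local Open Scope classical_set_scope.
Local Open Scope ring_scope.

Definition nonconstant (R : realType) (x : 'rV[R]_3) : Prop :=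
  exists i j, x ord0 i != x ord0 j.

Definition mean (R : realType) (x : 'rV[R]_3) : R :=
  (\sum_k x ord0 k) / 3.

(* Meaningful only for nonconstant x and y: otherwise the denominator is 0
   and corr x y = 0. *)
Definition corr (R : realType) (x y : 'rV[R]_3) : R :=
  (\sum_k (x ord0 k - mean x) * (y ord0 k - mean y)) /
  Num.sqrt ((\sum_k (x ord0 k - mean x) ^+ 2) *
            (\sum_k (y ord0 k - mean y) ^+ 2)).

Definition corr_map (R : realType) (A : 'M[R]_3) : 'M[R]_3 :=
  \matrix_(i, j) corr (row i A) (row j A).

Definition Amx (R : realType) (p : R * R * R) : 'M[R]_3 :=
  let: (a, b, c) := p in
  \matrix_(i, j) nth 0 (nth [::] [:: [:: 1; a; b];
                                     [:: a; 1; c];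
                                     [:: b; c; 1]] i) j.

Definition E3 (R : realType) : set (R * R * R) :=
  [set p | let: (a, b, c) := p in
    [/\ -1 <= a <= 1, -1 <= b <= 1, -1 <= c <= 1 &
        0 <= 1 + 2 * a * b * c - a ^+ 2 - b ^+ 2 - c ^+ 2]].

Definition E3nd (R : realType) : set (R * R * R) :=
  [set p | E3 p /\ forall i, nonconstant (row i (Amx p))].

(* The above-diagonal entries of corr_map (Amx p), as a total function on R^3.
   Only its values on E3nd matter; there it is the self-map of E3nd
   characterized by Amx (Tmap p) = corr_map (Amx p), see
   Amx_Tmap and Tmap_E3nd. *)
Definition Tmap (R : realType) (p : R * R * R) : R * R * R :=
  let C := corr_map (Amx p) in
  (C (inord 0) (inord 1), C (inord 0) (inord 2), C (inord 1) (inord 2)).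

Definition fixed_point (R : realType) (p : R * R * R) : Prop :=
  E3nd p /\ Tmap p = p.

Definition rel_nbhs (R : realType) (p : R * R * R) (V : set (R * R * R)) :
    Prop :=
  exists2 N : set (R * R * R), nbhs p N & V = @E3nd R `&` N.

(* A relative neighborhood is contained in E3nd, so an orbit that remains in V
   never leaves the domain of Tmap. *)
Definition lyapunov_stable (R : realType) (p : R * R * R) : Prop :=
  fixed_point p /\
  forall V, rel_nbhs p V ->
  exists2 U, rel_nbhs p U & forall x, U x -> forall n, V (iter n (@Tmap R) x).

Definition locally_asymptotically_stable (R : realType) (p : R * R * R) :
    Prop :=
  lyapunov_stable p /\
  exists2 U, rel_nbhs p U &
    forall x, U x -> iter n (@Tmap R) x @[n --> \oo] --> p.

Definition lyapunov_unstable (R : realType) (p : R * R * R) : Prop :=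
  fixed_point p /\ ~ lyapunov_stable p.

Section SelfMap.
Variable R : realType.
Implicit Types (x y u v : 'rV[R]_3) (p : R * R * R).

Let i0 : 'I_3 := inord 0.
Let i1 : 'I_3 := inord 1.
Let i2 : 'I_3 := inord 2.
Let d1 x : R := x ord0 i0 - x ord0 i1.
Let d2 x : R := x ord0 i1 - x ord0 i2.

(* Inner product of two centered vectors, in terms of the differences d1, d2
   of consecutive coordinates. *)
Definition cov (e f e' f' : R) : R :=
  (2 * (e * e' + f * f') + e * f' + f * e') / 3.

Local Notation covv x y := (cov (d1 x) (d2 x) (d1 y) (d2 y)).

Lemma sum3 (F : 'I_3 -> R) : \sum_k F k = F i0 + F i1 + F i2.
Proof.
rewrite !big_ord_recr big_ord0 /= add0r.
by congr (F _ + F _ + F _); apply/val_inj; rewrite /= inordK.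
Qed.

Lemma cov_ge0 (e f : R) : 0 <= cov e f e f.
Proof. by rewrite /cov; nra. Qed.

Lemma cov_gt0 (e f : R) : ~ (e = 0 /\ f = 0) -> 0 < cov e f e f.
Proof.
move=> ef; rewrite lt_def cov_ge0 andbT.
apply/eqP => h; apply: ef; rewrite /cov in h.
have he : e ^+ 2 = 0 by nra.
have hf : f ^+ 2 = 0 by nra.
by split; apply/eqP; rewrite -sqrf_eq0 ?he ?hf.
Qed.

Lemma corrE x y :
  corr x y = covv x y / (Num.sqrt (covv x x) * Num.sqrt (covv y y)).
Proof.
have H u v : \sum_k (u ord0 k - mean u) * (v ord0 k - mean v) = covv u v.
  by rewrite sum3 /mean !sum3 /cov /d1 /d2; field.
have H2 u : \sum_k (u ord0 k - mean u) ^+ 2 = covv u u.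
  by rewrite -H; apply: eq_bigr => k _; rewrite expr2.
by rewrite /corr H !H2 sqrtrM // cov_ge0.
Qed.

Lemma ord3P (i : 'I_3) : [\/ i = i0, i = i1 | i = i2].
Proof.
case: i => [[|[|[|//]]]] H; [apply: Or31|apply: Or32|apply: Or33];
  by apply/val_inj; rewrite /= inordK.
Qed.

Lemma nonconstantP x : nonconstant x <-> ~ (d1 x = 0 /\ d2 x = 0).
Proof.
split.
  move=> [i [j /eqP nij]] [/eqP]; rewrite subr_eq0 => /eqP h /eqP.
  rewrite subr_eq0 => /eqP h'; apply: nij.
  by case: (ord3P i) => ->; case: (ord3P j) => ->; rewrite ?h ?h'.
move=> h; case: (eqVneq (x ord0 i0) (x ord0 i1)) => [e1|];
  last by exists i0, i1.
case: (eqVneq (x ord0 i1) (x ord0 i2)) => [e2|]; last by exists i1, i2.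
by case: h; rewrite /d1 /d2 e1 e2 subrr.
Qed.

Lemma corrC x y : corr x y = corr y x.
Proof.
rewrite !corrE (mulrC (Num.sqrt (covv y y))); congr (_ * _).
by rewrite /cov; ring.
Qed.

Lemma corrxx x : nonconstant x -> corr x x = 1.
Proof.
move=> /nonconstantP/cov_gt0 h.
by rewrite corrE -expr2 sqr_sqrtr ?cov_ge0 // divff // gt_eqF.
Qed.

Lemma Amx_Tmap p : E3nd p -> Amx (Tmap p) = corr_map (Amx p).
Proof.
move=> [_ nc]; apply/matrixP => i j.
case: (ord3P i) => ->; case: (ord3P j) => ->; rewrite !mxE /= !inordK //= ?mxE;
  by rewrite ?corrxx // corrC.
Qed.

Lemma d_row (a b c : R) :
  [/\ (d1 (row i0 (Amx (a, b, c))) = 1 - a) *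
       (d2 (row i0 (Amx (a, b, c))) = a - b),
      (d1 (row i1 (Amx (a, b, c))) = a - 1) *
       (d2 (row i1 (Amx (a, b, c))) = 1 - c) &
      (d1 (row i2 (Amx (a, b, c))) = b - c) *
       (d2 (row i2 (Amx (a, b, c))) = c - 1)].
Proof. by split; split; rewrite /d1 /d2 !mxE !inordK. Qed.

Lemma E3ndP (a b c : R) :
  E3nd (a, b, c) <-> E3 (a, b, c) /\ (a, b, c) <> (1, 1, 1).
Proof.
have [r0 r1 r2] := d_row a b c.
split=> -[h nc]; split => //.
  move: (nc i0) => /nonconstantP + -[ha hb hc].
  by rewrite !r0 ha hb subrr; apply.
case: h => _ _ _ h i; apply/nonconstantP => -[e f]; apply: nc.
have sq (z : R) : z ^+ 2 <= 0 -> z = 0.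
  by move=> z2; apply/eqP; rewrite -sqrf_eq0 eq_le z2 sqr_ge0.
case: (ord3P i) e f => ->; rewrite ?r0 ?r1 ?r2 => e f.
- have ha : a = 1 by lra.
  have hb : b = 1 by lra.
  rewrite ha hb in h *; have : c - 1 = 0 by apply: sq; nra.
  by move=> hc; congr (_, _, _); lra.
- have ha : a = 1 by lra.
  have hc : c = 1 by lra.
  rewrite ha hc in h *; have : b - 1 = 0 by apply: sq; nra.
  by move=> hb; congr (_, _, _); lra.
- have hb : b = 1 by lra.
  have hc : c = 1 by lra.
  rewrite hb hc in h *; have : a - 1 = 0 by apply: sq; nra.
  by move=> ha; congr (_, _, _); lra.
Qed.

Lemma Tmap_E3nd p : E3nd p -> E3nd (Tmap p).
Proof.
move: p => [[a b] c] p_nd; have [E3p nc] := p_nd.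
have [r0 r1 r2] := d_row a b c.
move: (nc i0) (nc i1) (nc i2).
move=> /nonconstantP n0 /nonconstantP n1 /nonconstantP n2.
rewrite !r0 in n0; rewrite !r1 in n1; rewrite !r2 in n2.
have := cov_gt0 n0; have := cov_gt0 n1; have := cov_gt0 n2.
rewrite /Tmap !mxE !corrE -/i0 -/i1 -/i2 !r0 !r1 !r2.
set S0 := cov (1 - a) _ (1 - a) _; set S1 := cov (a - 1) _ (a - 1) _.
set S2 := cov (b - c) _ (b - c) _ => S2_gt0 S1_gt0 S0_gt0.
set X := cov (1 - a) _ (a - 1) _; set Y := cov (1 - a) _ (b - c) _.
set Z := cov (a - 1) _ (b - c) _.
have [s0 s0p s0E] : exists2 s, 0 < s & Num.sqrt S0 = s.
  by exists (Num.sqrt S0); rewrite ?sqrtr_gt0.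
have [s1 s1p s1E] : exists2 s, 0 < s & Num.sqrt S1 = s.
  by exists (Num.sqrt S1); rewrite ?sqrtr_gt0.
have [s2 s2p s2E] : exists2 s, 0 < s & Num.sqrt S2 = s.
  by exists (Num.sqrt S2); rewrite ?sqrtr_gt0.
have S0E : S0 = s0 ^+ 2 by rewrite -s0E sqr_sqrtr // ltW.
have S1E : S1 = s1 ^+ 2 by rewrite -s1E sqr_sqrtr // ltW.
have S2E : S2 = s2 ^+ 2 by rewrite -s2E sqr_sqrtr // ltW.
rewrite s0E s1E s2E.
have gXE : S0 * S1 - X ^+ 2 = ((1 - a) * (1 + a - b - c)) ^+ 2 / 3.
  by rewrite /S0 /S1 /X /cov; field.
have gYE : S0 * S2 - Y ^+ 2 = ((1 - b) * (1 + b - a - c)) ^+ 2 / 3.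
  by rewrite /S0 /S2 /Y /cov; field.
have gZE : S1 * S2 - Z ^+ 2 = ((1 - c) * (1 + c - a - b)) ^+ 2 / 3.
  by rewrite /S1 /S2 /Z /cov; field.
have det : S0 * S1 * S2 + 2 * X * Y * Z =
    S2 * X ^+ 2 + S1 * Y ^+ 2 + S0 * Z ^+ 2.
  by rewrite /S0 /S1 /S2 /X /Y /Z /cov; field.
have bnd (u v w e : R) : 0 < u -> 0 < v ->
    u ^+ 2 * v ^+ 2 - w ^+ 2 = e ^+ 2 / 3 -> -1 <= w / (u * v) <= 1.
  move=> u0 v0 h; rewrite -ler_norml normrM normfV.
  have uv : 0 < u * v by apply: mulr_gt0.
  rewrite (gtr0_norm uv) ler_pdivrMr // mul1r.
  have w2 : `|w| ^+ 2 <= (u * v) ^+ 2.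
    by rewrite real_normK ?num_real // exprMn -subr_ge0 h divr_ge0 ?sqr_ge0.
  by move: w2; rewrite ler_sqr // nnegrE ltW.
apply/E3ndP; split.
  rewrite S0E S1E S2E in gXE gYE gZE det.
  split; [exact: bnd gXE|exact: bnd gYE|exact: bnd gZE|].
  set D := (X in 0 <= X).
  suff -> : D = 0 by [].
  apply: (mulfI (x := s0 ^+ 2 * s1 ^+ 2 * s2 ^+ 2)).
    by rewrite !mulf_neq0 // ?expf_neq0 ?gt_eqF.
  rewrite mulr0 -(subrr (s0 ^+ 2 * s1 ^+ 2 * s2 ^+ 2 + 2 * X * Y * Z)).
  by rewrite {2}det /D; field; rewrite !gt_eqF.
move=> [X1 Y1 Z1].
have eq1 (u v w : R) : 0 < u -> 0 < v -> w / (u * v) = 1 -> w = u * v.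
  move=> u0 v0 h; have uv : u * v != 0 by rewrite mulf_neq0 // gt_eqF.
  by rewrite -[w](divfK uv) h mul1r.
move/eq1: X1 => /(_ s0p s1p) X1.
move/eq1: Y1 => /(_ s0p s2p) Y1.
move/eq1: Z1 => /(_ s1p s2p) Z1.
have X0 : 0 < X by rewrite X1 mulr_gt0.
have Y0 : 0 < Y by rewrite Y1 mulr_gt0.
have Z0 : 0 < Z by rewrite Z1 mulr_gt0.
have sq0 (z : R) : 0 = z ^+ 2 / 3 -> z == 0.
  by move=> h; rewrite -sqrf_eq0; apply/eqP; lra.
have gX : (1 - a) * (1 + a - b - c) == 0.
  by apply: sq0; rewrite -gXE S0E S1E X1 exprMn subrr.
have gY : (1 - b) * (1 + b - a - c) == 0.
  by apply: sq0; rewrite -gYE S0E S2E Y1 exprMn subrr.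
have gZ : (1 - c) * (1 + c - a - b) == 0.
  by apply: sq0; rewrite -gZE S1E S2E Z1 exprMn subrr.
case: E3p => _ _ _ detA.
have sqle (z : R) : z ^+ 2 <= 0 -> z = 0.
  by move=> z2; apply/eqP; rewrite -sqrf_eq0 eq_le z2 sqr_ge0.
have neg (z w : R) : 0 < w -> w = - (2 * z ^+ 2 / 3) -> False.
  move=> + wE; rewrite wE oppr_gt0 ltNge.
  by rewrite divr_ge0 // mulr_ge0 // sqr_ge0.
have a1 : a != 1.
  apply/eqP => ea; rewrite ea in detA.
  have bc : b - c = 0 by apply: sqle; lra.
  have : Y = - (2 * (1 - b) ^+ 2 / 3).
    by rewrite /Y /cov ea (subr0_eq bc); field.
  exact: neg Y0.
have b1 : b != 1.
  apply/eqP => eb; rewrite eb in detA.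
  have ac : a - c = 0 by apply: sqle; lra.
  have : X = - (2 * (1 - a) ^+ 2 / 3).
    by rewrite /X /cov eb -(subr0_eq ac); field.
  exact: neg X0.
have c1 : c != 1.
  apply/eqP => ec; rewrite ec in detA.
  have ab : a - b = 0 by apply: sqle; lra.
  have : X = - (2 * (1 - a) ^+ 2 / 3).
    by rewrite /X /cov ec -(subr0_eq ab); field.
  exact: neg X0.
rewrite mulf_eq0 subr_eq0 eq_sym (negbTE a1) /= in gX.
rewrite mulf_eq0 subr_eq0 eq_sym (negbTE b1) /= in gY.
rewrite mulf_eq0 subr_eq0 eq_sym (negbTE c1) /= in gZ.
move/eqP: gX; move/eqP: gY; move/eqP: gZ => h1 h2 h3.
by case/eqP: a1; lra.
Qed.
End SelfMap.

(* Main.v *)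
Require Import Defs.
From mathcomp Require Import all_boot all_order all_algebra.
From mathcomp Require Import all_classical all_reals all_analysis.
From mathcomp Require Import ring lra.

(** Write [F(a; b, c)] for the correlation of the rows [(1, a, b)] and
    [(a, 1, c)], so that [T(a, b, c) = (F(a; b, c), F(b; a, c), F(c; a, b))].
    After cancelling constants, [F(a; b, c) = g / (2 sqrt(s(a, b) s(a, c)))]
    with polynomials [g] (row_cov) and [s] (row_var) satisfying the Gram
    identity
    [4 s(a, b) s(a, c) - g^2 = 3 ((1 - a) (1 + a - b - c))^2].

    Stability.  At [(1, -1, -1)] the three centered rows are collinear, so the
    right-hand sides of the three Gram identities are squares of quantities
    that vanish there.  Hence [1 - F^2], and with it the distance from [F] to
    its limit value [1] or [-1], is of second order in the distance to the
    fixed point: [T] is superattracting, in particular it contracts a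
    neighborhood by [1/2] ([corr_entry_near1], [corr_entry_nearN1],
    [stable_of_contraction]).  The other two points have the same entries up
    to the symmetries of [F].

    Instability.  Each of the four points lies on a curve in the domain that
    [T] maps to itself and along which [T] expands ([unstable_along_curve]).
    For [(-1/2, -1/2, -1/2)] the curve is [(a, a, 2 a^2 - 1)], i.e. the
    correlation matrices of three plane vectors, one on the bisector of the
    two others; there [T] acts by [a |-> a / sqrt(4 a^2 + 6 a + 3)], which has
    derivative [3/2] at [-1/2].  For [(0, 0, -1)] it is [(t, -t, -1)], where
    the third row is the opposite of the second; there [T] acts by
    [t |-> 4 t / sqrt((1 + 3 t^2) (3 + t^2))], with derivative [4 / sqrt 3]
    at [0].  The last two points follow by permuting coordinates. *)

Set Implicit Arguments.
Unset Strict Implicit.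
Unset Printing Implicit Defensive.

Import Order.TTheory GRing.Theory Num.Theory.
Import numFieldNormedType.Exports.

Local Open Scope classical_set_scope.
Local Open Scope ring_scope.

(** * Stability criteria *)

Section Criteria.
Variable R : realType.
Implicit Types (p x : R * R * R) (t : R).

Lemma norm_triple_le (a b c e : R) :
  (`|(a, b, c)| <= e) = [&& `|a| <= e, `|b| <= e & `|c| <= e].
Proof. by rewrite !prod_normE /= !ge_max andbA. Qed.

Lemma dist_triple_le (a b c a' b' c' e : R) :
  (`|(a, b, c) - (a', b', c')| <= e) =
  [&& `|a - a'| <= e, `|b - b'| <= e & `|c - c'| <= e].
Proof. exact: norm_triple_le. Qed.

Lemma rel_nbhs_ball p (e : R) : 0 < e ->
  rel_nbhs p [set x | E3nd x /\ `|x - p| < e].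
Proof.
move=> e0; exists [set x | `|x - p| < e] => //.
by apply/nbhs_ballP; exists e => //= x; rewrite ball_prod_normE /= distrC.
Qed.

Lemma rel_nbhsP p (V : set (R * R * R)) : rel_nbhs p V ->
  exists2 e : R, 0 < e & forall x, E3nd x -> `|x - p| < e -> V x.
Proof.
move=> [N /nbhs_ballP[e /= e0 eN] ->]; exists e => // x Ex xp; split=> //.
by apply: eN; rewrite ball_prod_normE /= distrC.
Qed.

(** The distance to [p] at least halves at each step, so the orbit never leaves
    the ball on which the estimate holds, and converges geometrically. *)
Lemma stable_of_contraction p (e : R) : E3nd p -> 0 < e ->
  (forall x, E3nd x -> `|x - p| < e -> `|Tmap x - p| <= 2^-1 * `|x - p|) ->
  locally_asymptotically_stable p.
Proof.
move=> Ep e0 contr.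
have iterP x n : E3nd x -> `|x - p| < e -> E3nd (iter n (@Tmap R) x) /\
    `|iter n (@Tmap R) x - p| <= 2^-1 ^+ n * `|x - p|.
  move=> Ex xe; elim: n => [|n [En IHn]]; first by rewrite expr0 mul1r.
  split; first exact: Tmap_E3nd.
  have half1 : 2^-1 ^+ n <= 1 :> R by apply: exprn_ile1; lra.
  have le_e : `|iter n (@Tmap R) x - p| < e.
    apply: le_lt_trans xe; apply: le_trans IHn _.
    by rewrite ler_piMl.
  apply: le_trans (contr _ En le_e) _.
  by rewrite exprS -mulrA ler_pM2l.
have fp : fixed_point p.
  split=> //; apply/eqP; rewrite -subr_eq0 -normr_le0.
  have := contr p Ep; rewrite subrr normr0 mulr0; exact.
split.
  split=> // V /rel_nbhsP[d d0 dV].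
  exists [set x | E3nd x /\ `|x - p| < Num.min d e].
    by apply: rel_nbhs_ball; rewrite lt_min d0 e0.
  move=> x [Ex]; rewrite lt_min => /andP[xd xe] n.
  have [En le_n] := iterP x n Ex xe; apply: dV => //.
  apply: le_lt_trans xd; apply: le_trans le_n _.
  by rewrite ler_piMl //; apply: exprn_ile1; lra.
exists [set x | E3nd x /\ `|x - p| < e]; first exact: rel_nbhs_ball.
move=> x [Ex xe].
apply/subr_cvg0/norm_cvg0P.
apply: (@squeeze_cvgr _ _ _ _ (fun=> 0) (fun n => 2^-1 ^+ n * `|x - p|)).
- near=> n; rewrite normr_ge0 /=.
  by have [] := iterP x n Ex xe.
- exact: cvg_cst.
- rewrite -[X in _ --> X](mul0r `|x - p|).
  apply: cvgM; last exact: cvg_cst.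
  by apply: cvg_expr; rewrite ger0_norm; lra.
Unshelve. all: by end_near.
Qed.

(** An orbit starting on the curve stays on it, and its parameter grows by a
    factor [k] at each step as long as the orbit is within [d] of the fixed
    point, so it has to leave that neighborhood. *)
Lemma unstable_along_curve (gam : R -> R * R * R) (f : R -> R) (k C d : R) :
  1 < k -> 0 < d -> f 0 = 0 ->
  (forall t, 0 <= t < d -> E3nd (gam t)) ->
  (forall t, 0 <= t < d -> Tmap (gam t) = gam (f t)) ->
  (forall t, 0 <= t < d -> k * t <= f t) ->
  (forall t, 0 <= t -> t <= `|gam t - gam 0|) ->
  (forall t, 0 <= t < d -> `|gam t - gam 0| <= C * t) ->
  lyapunov_unstable (gam 0).
Proof.
move=> k1 d0 f0 Egam Tgam fk lb ub.
have z0 : 0 <= (0 : R) < d by rewrite lexx.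
split; first by split; [exact: Egam | rewrite Tgam // f0].
move=> [_ /(_ _ (rel_nbhs_ball (gam 0) d0))[U /rel_nbhsP[e e0 eU] UV]].
have [t0 [t0_gt0 t0d t0e]] : exists t, [/\ 0 < t, t < d & C * t < e].
  have C1 : 0 < `|C| + 1 by rewrite ltr_wpDl.
  (* [C] may vanish or be negative, hence [`|C| + 1] in the denominator. *)
  exists (Num.min (d / 2) (e / 2 / (`|C| + 1))).
  set t := Num.min _ _.
  have t_gt0 : 0 < t by rewrite lt_min !divr_gt0.
  have td : t <= d / 2 by rewrite ge_min lexx.
  have te : t * (`|C| + 1) <= e / 2.
    by rewrite -ler_pdivlMr // ge_min lexx orbT.
  split=> //; first by lra.
  have : C * t <= `|C| * t by rewrite ler_wpM2r ?ler_norm // ltW.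
  lra.
have t0_in : 0 <= t0 < d by rewrite ltW.
have q0 : 0 < (k - 1) * t0 by rewrite mulr_gt0 // subr_gt0.
have Ut0 : U (gam t0) by apply: eU; [exact: Egam | exact: le_lt_trans (ub _ _) _].
have orbit n : exists t, [/\ iter n (@Tmap R) (gam t0) = gam t,
    t0 + n%:R * ((k - 1) * t0) <= t & 0 <= t < d].
  elim: n => [|n [t [Et tn t_in]]].
    by exists t0; split=> //; rewrite mul0r addr0.
  have step : (k - 1) * t0 <= (k - 1) * t.
    rewrite ler_wpM2l //; first by lra.
    apply: le_trans tn.
    by rewrite lerDl mulr_ge0 // ltW.
  have ftn : t0 + n.+1%:R * ((k - 1) * t0) <= f t.
    by have := fk t t_in; rewrite -natr1; lra.
  have ft0 : 0 <= f t.
    by apply: le_trans ftn; rewrite addr_ge0 ?(ltW t0_gt0) // mulr_ge0 // ltW.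
  have Eft : iter n.+1 (@Tmap R) (gam t0) = gam (f t) by rewrite iterS Et Tgam.
  exists (f t); split=> //; rewrite ft0 /=.
  have [_] := UV _ Ut0 n.+1; rewrite Eft; exact: le_lt_trans (lb _ ft0).
have [t [_ tn /andP[_ td]]] := orbit (Num.bound (d / ((k - 1) * t0))).
have := archi_boundP (ltW (divr_gt0 d0 q0)); rewrite ltr_pdivrMr // => dn.
by have := lt_trans (le_lt_trans tn td) dn; lra.
Qed.

End Criteria.

(** * The entries of the correlation map *)

Section Entries.
Variable R : realType.
Implicit Types a b c : R.

(** [2/3] of this is the centered square norm of [(1, a, b)]. *)
Definition row_var a b : R := 1 + a ^+ 2 + b ^+ 2 - a - b - a * b.

(** A third of this is the centered inner product of [(1, a, b)] and
    [(a, 1, c)]. *)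
Definition row_cov a b c : R := 6 * a + 3 * b * c - (1 + a + b) * (1 + a + c).

Definition corr_entry a b c : R :=
  row_cov a b c / (2 * Num.sqrt (row_var a b * row_var a c)).

Lemma row_varC a b : row_var a b = row_var b a.
Proof. by rewrite /row_var; ring. Qed.

Lemma corr_entryC a b c : corr_entry a b c = corr_entry a c b.
Proof.
rewrite /corr_entry (mulrC (row_var a b)); congr (_ / _).
by rewrite /row_cov; ring.
Qed.

Lemma corr_rescale (x y z u v w : R) :
  x = u / 3 -> y = 2 / 3 * v -> z = 2 / 3 * w ->
  x / Num.sqrt (y * z) = u / (2 * Num.sqrt (v * w)).
Proof.
move=> -> -> ->.
have -> : 2 / 3 * v * (2 / 3 * w) = (2 / 3) ^+ 2 * (v * w) by field.
rewrite sqrtrM ?sqr_ge0 // sqrtr_sqr ger0_norm; last by lra.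
have -> : 2 / 3 * Num.sqrt (v * w) = (2 * Num.sqrt (v * w)) / 3 by field.
by rewrite invf_div mulrA divfK.
Qed.

Lemma TmapE a b c :
  Tmap (a, b, c) = (corr_entry a b c, corr_entry b a c, corr_entry c a b).
Proof.
rewrite /Tmap /Amx /corr_map /corr /corr_entry !mxE.
congr (_, _, _); [ | rewrite (row_varC b a) | rewrite (row_varC c a) (row_varC c b)];
  by apply: corr_rescale; rewrite sum3 /mean !sum3 !mxE !inordK //=
    /row_cov /row_var; field.
Qed.

(** The squared quantity on the right is the determinant of [(1, 1, 1)] and the
    two rows; it vanishes exactly when the centered rows are parallel. *)
Lemma gram_identity a b c :
  4 * (row_var a b * row_var a c) - row_cov a b c ^+ 2 =
  3 * ((1 - a) * (1 + a - b - c)) ^+ 2.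
Proof. by rewrite /row_var /row_cov; ring. Qed.

(** Since [1 - |F| <= 1 - F^2], the Gram identity bounds the distance of [F]
    to [+-1] by the square of [e]. *)
Lemma corr_entry_near_unit a b c (e : R) :
  3 <= row_var a b -> 3 <= row_var a c ->
  `|(1 - a) * (1 + a - b - c)| <= e ->
  1 - `|corr_entry a b c| <= e ^+ 2 / 12 /\ `|corr_entry a b c| <= 1.
Proof.
move=> v1 v2 Ke.
set P := row_var a b * row_var a c.
have P9 : 9 <= P by rewrite /P; nra.
have P0 : 0 < P by lra.
have F2 : corr_entry a b c ^+ 2 = row_cov a b c ^+ 2 / (4 * P).
  rewrite /corr_entry expr_div_n exprMn sqr_sqrtr 1?ltW //.
  by congr (_ / (_ * _)); ring.
have K2 : ((1 - a) * (1 + a - b - c)) ^+ 2 <= e ^+ 2.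
  by rewrite -(real_normK (num_real (_ * _))) ler_sqr ?nnegrE // (le_trans _ Ke).
have F2E : 1 - `|corr_entry a b c| ^+ 2 =
    3 * ((1 - a) * (1 + a - b - c)) ^+ 2 / (4 * P).
  rewrite real_normK ?num_real // F2 -gram_identity -/P.
  by field; rewrite gt_eqF.
have F1 : `|corr_entry a b c| <= 1.
  have F2_le1 : 0 <= 1 - `|corr_entry a b c| ^+ 2.
    by rewrite F2E divr_ge0 // mulr_ge0 ?sqr_ge0 // ltW.
  by have := normr_ge0 (corr_entry a b c); nra.
split=> //.
have : 1 - `|corr_entry a b c| ^+ 2 <= e ^+ 2 / 12.
  rewrite F2E ler_pdivrMr; last by lra.
  have : 0 <= e ^+ 2 by apply: sqr_ge0.
  nra.
have := normr_ge0 (corr_entry a b c); nra.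
Qed.

(** The lower bound 3 on the variances is a perturbation of their value 4 at
    the fixed point. The determinant is at most [5 m] because its factor [1 - a]
    is at most [m] and the other one is close to 4, and
    [(5 m)^2 / 12 <= m / 2] for [m <= 1/10]. *)
Lemma corr_entry_near1 a b c (m : R) : m <= 1 / 10 ->
  `|a - 1| <= m -> `|b + 1| <= m -> `|c + 1| <= m ->
  `|corr_entry a b c - 1| <= 2^-1 * m.
Proof.
rewrite !ler_norml => m1 /andP[a1 a2] /andP[b1 b2] /andP[c1 c2].
have m0 : 0 <= m by lra.
have va : 3 <= row_var a b by rewrite /row_var; nra.
have vc : 3 <= row_var a c by rewrite /row_var; nra.
have cov_gt0 : 0 < row_cov a b c by rewrite /row_cov; nra.
have Ke : `|(1 - a) * (1 + a - b - c)| <= 5 * m.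
  by rewrite ler_norml; apply/andP; split; nra.
have [] := corr_entry_near_unit va vc Ke.
have F0 : 0 <= corr_entry a b c.
  by rewrite /corr_entry divr_ge0 ?mulr_ge0 ?sqrtr_ge0 // ltW.
rewrite (ger0_norm F0) => *; nra.
Qed.

(** Here the factor of the determinant that is small is [1 + a - b - c], at most
    [3 m], while [1 - a] is close to 2. *)
Lemma corr_entry_nearN1 a b c (m : R) : m <= 1 / 10 ->
  `|a + 1| <= m -> `|b - 1| <= m -> `|c + 1| <= m ->
  `|corr_entry a b c + 1| <= 2^-1 * m.
Proof.
rewrite !ler_norml => m1 /andP[a1 a2] /andP[b1 b2] /andP[c1 c2].
have m0 : 0 <= m by lra.
have va : 3 <= row_var a b by rewrite /row_var; nra.
have vc : 3 <= row_var a c by rewrite /row_var; nra.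
have cov_lt0 : row_cov a b c < 0 by rewrite /row_cov; nra.
have Ke : `|(1 - a) * (1 + a - b - c)| <= 7 * m.
  by rewrite ler_norml; apply/andP; split; nra.
have [] := corr_entry_near_unit va vc Ke.
have F0 : corr_entry a b c <= 0.
  by rewrite /corr_entry mulr_le0_ge0 ?invr_ge0 ?mulr_ge0 ?sqrtr_ge0 // ltW.
rewrite (ler0_norm F0) => *; nra.
Qed.

End Entries.

(** * The superattracting points *)

Section Stable.
Variable R : realType.

Lemma E3nd_sum_lt (a b c : R) : E3 (a, b, c) -> a + b + c < 3 ->
  E3nd (a, b, c).
Proof.
move=> Ep lt3; apply/E3ndP; split=> // -[a1 b1 c1].
by move: lt3; rewrite a1 b1 c1 ltNge => /negP; apply; lra.
Qed.

Lemma stable_of_entries (a0 b0 c0 : R) : E3nd (a0, b0, c0) ->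
  (forall a b c m : R, m <= 1 / 10 ->
    `|a - a0| <= m -> `|b - b0| <= m -> `|c - c0| <= m ->
    [/\ `|corr_entry a b c - a0| <= 2^-1 * m,
        `|corr_entry b a c - b0| <= 2^-1 * m &
        `|corr_entry c a b - c0| <= 2^-1 * m]) ->
  locally_asymptotically_stable (a0, b0, c0).
Proof.
move=> Ep near; apply: (@stable_of_contraction _ _ (1 / 10) Ep) => [|]; first by lra.
move=> [[a b] c] _ /ltW; set m := `|(a, b, c) - _| => m1.
have : m <= m by [].
rewrite {1}/m dist_triple_le => /and3P[ha hb hc].
by rewrite TmapE dist_triple_le; apply/and3P; exact: near.
Qed.

Lemma stable_1NN : locally_asymptotically_stable (1 : R, -1 : R, -1 : R).
Proof.
apply: stable_of_entries => [|a b c m m1].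
  by apply: E3nd_sum_lt; [split |]; lra.
rewrite !opprK => ha hb hc; split.
- exact: corr_entry_near1.
- exact: corr_entry_nearN1.
- exact: corr_entry_nearN1.
Qed.

Lemma stable_N1N : locally_asymptotically_stable (-1 : R, 1 : R, -1 : R).
Proof.
apply: stable_of_entries => [|a b c m m1].
  by apply: E3nd_sum_lt; [split |]; lra.
rewrite !opprK => ha hb hc; split.
- exact: corr_entry_nearN1.
- exact: corr_entry_near1.
- by rewrite corr_entryC; exact: corr_entry_nearN1.
Qed.

Lemma stable_NN1 : locally_asymptotically_stable (-1 : R, -1 : R, 1 : R).
Proof.
apply: stable_of_entries => [|a b c m m1].
  by apply: E3nd_sum_lt; [split |]; lra.
rewrite !opprK => ha hb hc; split.
- by rewrite corr_entryC; exact: corr_entry_nearN1.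
- by rewrite corr_entryC; exact: corr_entry_nearN1.
- exact: corr_entry_near1.
Qed.

End Stable.

(** * The expanding curves *)

Section Unstable.
Variable R : realType.
Implicit Types a t : R.

Lemma bisector_quad_gt0 a : 0 < 4 * a ^+ 2 + 6 * a + 3.
Proof. by have := sqr_ge0 (2 * a + 3 / 2); nra. Qed.

(** On the curve [(a, a, 2 a^2 - 1)] both variances contain the factor
    [(1 - a)^2], which cancels against the covariance. *)
Lemma bisector_row_var a : row_var a (2 * a ^+ 2 - 1) =
  (1 - a) ^+ 2 * (4 * a ^+ 2 + 6 * a + 3).
Proof. by rewrite /row_var; ring. Qed.

Lemma bisector_entry_side a : a < 1 ->
  corr_entry a a (2 * a ^+ 2 - 1) = a / Num.sqrt (4 * a ^+ 2 + 6 * a + 3).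
Proof.
move=> a1; have s0 := bisector_quad_gt0 a.
rewrite /corr_entry bisector_row_var.
have -> : row_var a a * ((1 - a) ^+ 2 * (4 * a ^+ 2 + 6 * a + 3)) =
    ((1 - a) ^+ 2) ^+ 2 * (4 * a ^+ 2 + 6 * a + 3) by rewrite /row_var; ring.
have -> : row_cov a a (2 * a ^+ 2 - 1) = 2 * a * (1 - a) ^+ 2.
  by rewrite /row_cov; ring.
rewrite sqrtrM ?sqr_ge0 // sqrtr_sqr ger0_norm ?sqr_ge0 //.
have sq0 : Num.sqrt (4 * a ^+ 2 + 6 * a + 3) != 0 by rewrite gt_eqF ?sqrtr_gt0.
have n0 : 1 - a != 0 by rewrite gt_eqF ?subr_gt0.
by field; rewrite sq0 n0.
Qed.

Lemma bisector_entry_opening a : a < 1 ->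
  corr_entry (2 * a ^+ 2 - 1) a a =
  2 * (a / Num.sqrt (4 * a ^+ 2 + 6 * a + 3)) ^+ 2 - 1.
Proof.
move=> a1; have s0 := bisector_quad_gt0 a.
rewrite /corr_entry row_varC bisector_row_var -expr2 sqrtr_sqr.
rewrite ger0_norm; last by rewrite mulr_ge0 ?sqr_ge0 // ltW.
rewrite expr_div_n sqr_sqrtr 1?ltW // /row_cov.
have n0 : 1 - a != 0 by rewrite gt_eqF ?subr_gt0.
by field; rewrite n0 gt_eqF.
Qed.

(** The rows [(-t, -1, 1)] and [(t, 1, -1)] are opposite, so one correlation is
    [-1] and the two others are opposite to each other. *)
Lemma opposite_rows_entry t :
  corr_entry t (- t) (-1) =
  4 * t / Num.sqrt ((1 + 3 * t ^+ 2) * (3 + t ^+ 2)).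
Proof.
have t2 := sqr_ge0 t.
rewrite /corr_entry.
have -> : row_var t (- t) * row_var t (-1) =
    (1 + 3 * t ^+ 2) * (3 + t ^+ 2) by rewrite /row_var; ring.
have -> : row_cov t (- t) (-1) = 8 * t by rewrite /row_cov; ring.
have P0 : 0 < (1 + 3 * t ^+ 2) * (3 + t ^+ 2) by apply: mulr_gt0; lra.
by field; rewrite gt_eqF ?sqrtr_gt0.
Qed.

Lemma opposite_rows_entryN t :
  corr_entry (- t) t (-1) =
  - (4 * t / Num.sqrt ((1 + 3 * t ^+ 2) * (3 + t ^+ 2))).
Proof.
by rewrite -{2}[t]opprK opposite_rows_entry sqrrN mulrN mulNr.
Qed.

Lemma opposite_rows_entryN1 t : corr_entry (-1) t (- t) = -1.
Proof.
have t2 := sqr_ge0 t.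
have -> : corr_entry (-1) t (- t) =
    (- (2 * (3 + t ^+ 2))) / (2 * Num.sqrt ((3 + t ^+ 2) ^+ 2)).
  by congr (_ / (_ * Num.sqrt _)); rewrite /row_cov /row_var; ring.
by rewrite sqrtr_sqr ger0_norm ?mulNr ?divff // ?mulf_neq0 ?gt_eqF //; lra.
Qed.

Lemma opposite_rows_expand t : 0 <= t < 3 / 10 ->
  2 * t <= 4 * t / Num.sqrt ((1 + 3 * t ^+ 2) * (3 + t ^+ 2)).
Proof.
move=> /andP[t0 td]; have t2 : t ^+ 2 <= 9 / 100 by nra.
have P0 : 0 < (1 + 3 * t ^+ 2) * (3 + t ^+ 2) by apply: mulr_gt0; nra.
have P4 : Num.sqrt ((1 + 3 * t ^+ 2) * (3 + t ^+ 2)) <= 2.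
  have -> : 2 = Num.sqrt (2 ^+ 2) :> R by rewrite sqrtr_sqr ger0_norm.
  by apply: ler_wsqrtr; nra.
by rewrite ler_pdivlMr ?sqrtr_gt0 //; nra.
Qed.

(** The curve is parametrized by [t = - 1/2 - a], so that the side entry
    [a / sqrt(q)] becomes the displacement [(1/2 + t) / sqrt(q) - 1/2]. Its
    derivative at [0] is [3/2]; any factor between 1 and 3/2 would do for the
    expansion, here 5/4. *)
Lemma unstable_half :
  lyapunov_unstable (- (1 / 2) : R, - (1 / 2) : R, - (1 / 2) : R).
Proof.
pose gam t : R * R * R :=
  (- (1 / 2) - t, - (1 / 2) - t, 2 * (- (1 / 2) - t) ^+ 2 - 1).
have -> : (- (1 / 2), - (1 / 2), - (1 / 2)) = gam 0.
  by rewrite /gam; congr (_, _, _); field.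
pose q t : R := 1 - 2 * t + 4 * t ^+ 2.
have qE t : 4 * (- (1 / 2) - t) ^+ 2 + 6 * (- (1 / 2) - t) + 3 = q t.
  by rewrite /q; field.
apply: (@unstable_along_curve _ gam
  (fun t => (1 / 2 + t) / Num.sqrt (q t) - 1 / 2) (5 / 4) 3 (1 / 10)).
- lra.
- lra.
- by rewrite /q expr0n !mulr0 subr0 !addr0 sqrtr1 divr1 subrr.
- move=> t /andP[t0 td]; apply: E3nd_sum_lt; last by nra.
  split; [lra | lra | nra |].
  by rewrite le_eqVlt; apply/orP; left; apply/eqP; field.
- move=> t /andP[t0 td]; have a1 : - (1 / 2) - t < 1 by lra.
  rewrite /gam TmapE bisector_entry_side // bisector_entry_opening // qE.
  have -> : - (1 / 2) - ((1 / 2 + t) / Num.sqrt (q t) - 1 / 2) =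
      (- (1 / 2) - t) / Num.sqrt (q t) by ring.
  by [].
- move=> t /andP[t0 td].
  have q0 : 0 < q t by rewrite -qE bisector_quad_gt0.
  rewrite lerBrDr ler_pdivlMr ?sqrtr_gt0 //.
  rewrite -ler_sqr ?nnegrE; [|by rewrite mulr_ge0 ?sqrtr_ge0 //; lra|by lra].
  rewrite exprMn sqr_sqrtr ?(ltW q0) // -subr_ge0.
  have -> : (1 / 2 + t) ^+ 2 - (5 / 4 * t + 1 / 2) ^+ 2 * q t =
      t * (1 / 4 + 15 / 16 * t - 15 / 8 * t ^+ 2 - 25 / 4 * (t * t ^+ 2)).
    by rewrite /q; field.
  have t2 : t ^+ 2 <= 1 / 100 by nra.
  have t3 : t * t ^+ 2 <= 1 / 1000 by nra.
  by rewrite mulr_ge0 //; lra.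
- move=> t t0; have : `|gam t - gam 0| <= `|gam t - gam 0| by [].
  rewrite {1}/gam dist_triple_le => /and3P[+ _ _].
  by rewrite subr0 opprK addrAC addNr add0r normrN (ger0_norm t0).
- move=> t /andP[t0 td]; rewrite /gam dist_triple_le !ler_norml.
  by apply/and3P; split; apply/andP; split; nra.
Qed.

(** Stated for a general curve so as to cover the three placements of the
    entries [t], [-t] and [-1] above the diagonal. Near [0] the displacement
    map has slope [4 / sqrt 3 > 2]. *)
Lemma unstable_opposite_rows (gam : R -> R * R * R) :
  (forall t, 0 <= t <= 1 -> E3nd (gam t)) ->
  (forall t, Tmap (gam t) =
    gam (4 * t / Num.sqrt ((1 + 3 * t ^+ 2) * (3 + t ^+ 2)))) ->
  (forall t, `|gam t - gam 0| = `|t|) ->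
  lyapunov_unstable (gam 0).
Proof.
move=> Egam Tgam dist_gam.
apply: (@unstable_along_curve _ gam
  (fun t => 4 * t / Num.sqrt ((1 + 3 * t ^+ 2) * (3 + t ^+ 2))) 2 1 (3 / 10)).
- lra.
- lra.
- by rewrite mulr0 mul0r.
- by move=> t /andP[t0 td]; apply: Egam; lra.
- by move=> t _; exact: Tgam.
- exact: opposite_rows_expand.
- by move=> t t0; rewrite dist_gam ger0_norm.
- by move=> t /andP[t0 _]; rewrite dist_gam ger0_norm // mul1r.
Qed.

Lemma unstable_N00 : lyapunov_unstable (-1 : R, 0 : R, 0 : R).
Proof.
have -> : (-1, 0, 0) = (-1, 0, - 0) :> R * R * R by rewrite oppr0.
apply: (unstable_opposite_rows (gam := fun t => (-1, t, - t))) => t.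
- by move=> t1; apply: E3nd_sum_lt; [split |]; lra.
- rewrite TmapE opposite_rows_entryN1 (corr_entryC t) (corr_entryC (- t)).
  by rewrite opposite_rows_entry opposite_rows_entryN.
- rewrite !prod_normE /= subrr !oppr0 !addr0 normrN normr0.
  by rewrite (max_r (normr_ge0 t)) maxxx.
Qed.

Lemma unstable_0N0 : lyapunov_unstable (0 : R, -1 : R, 0 : R).
Proof.
have -> : (0, -1, 0) = (0, -1, - 0) :> R * R * R by rewrite oppr0.
apply: (unstable_opposite_rows (gam := fun t => (t, -1, - t))) => t.
- by move=> t1; apply: E3nd_sum_lt; [split |]; lra.
- rewrite TmapE opposite_rows_entryN1 (corr_entryC t).
  by rewrite opposite_rows_entry opposite_rows_entryN.
- rewrite !prod_normE /= subrr !oppr0 !addr0 normrN normr0.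
  by rewrite (max_l (normr_ge0 t)) maxxx.
Qed.

Lemma unstable_00N : lyapunov_unstable (0 : R, 0 : R, -1 : R).
Proof.
have -> : (0, 0, -1) = (0, - 0, -1) :> R * R * R by rewrite oppr0.
apply: (unstable_opposite_rows (gam := fun t => (t, - t, -1))) => t.
- by move=> t1; apply: E3nd_sum_lt; [split |]; lra.
- rewrite TmapE opposite_rows_entryN1.
  by rewrite opposite_rows_entry opposite_rows_entryN.
- rewrite !prod_normE /= subrr !oppr0 !addr0 normrN normr0.
  by rewrite maxxx (max_l (normr_ge0 t)).
Qed.

End Unstable.

(** * Stability type of the seven fixed points *)

Theorem theorem4 (R : realType) :
  [/\ locally_asymptotically_stable (1 : R, -1 : R, -1 : R),
      locally_asymptotically_stable (-1 : R, 1 : R, -1 : R) &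
      locally_asymptotically_stable (-1 : R, -1 : R, 1 : R)] /\
  [/\ lyapunov_unstable (- (1 / 2) : R, - (1 / 2) : R, - (1 / 2) : R),
      lyapunov_unstable (-1 : R, 0 : R, 0 : R),
      lyapunov_unstable (0 : R, -1 : R, 0 : R) &
      lyapunov_unstable (0 : R, 0 : R, -1 : R)].
Proof.
split; split.
- exact: stable_1NN.
- exact: stable_N1N.
- exact: stable_NN1.
- exact: unstable_half.
- exact: unstable_N00.
- exact: unstable_0N0.
- exact: unstable_00N.
Qed.
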